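(* Let $G$ be a tree on $k$ vertices and $n\ge 1$. Then $$\begin{aligned}W(\Gamma^G_n)&=\frac{(k-1)^2(2k^2-2k-1)}{k^3(2k-1)}\,2^nk^{2n}-\frac{2(k-1)^2}{k^2}\,nk^{2n}+\frac{2(k+1)(k-1)}{k^3}\,k^{2n}-\frac{2(k+1)(k-1)}{k(2k-1)}\,k^n\\&\quad+\left(\frac{2}{k^2}\,nk^{2n}-\frac{k^2+2}{k^3(k-1)}\,k^{2n}+\frac{k+2}{k^2(k-1)}\,k^n\right)W(G).\end{aligned}$$
   Context: Let $G=(V,E)$ be a finite tree with vertex set $V$ of size $k$, and fix an orientation of each edge, so that each edge becomes an ordered pair $e=(s,t)$. Each oriented edge $e=(s,t)$ acts on the set $V^*$ of finite words over the alphabet $V$ by the recursive rule: $e(\emptyset)=\emptyset$, $e(sw)=t\,e(w)$, $e(tw)=sw$, and $e(xw)=xw$ for $x\in V\setminus\{s,t\}$ (words are read left to right, $w\in V^*$). This action preserves word length. For $n\ge 1$, the Schreier graph $\Gamma_n^G$ is the multigraph with vertex set $V^n$ having, for each $u\in V^n$ and each oriented edge $e$ of $G$, one edge joining $u$ and $e(u)$, labelled $e$ (a loop if $e(u)=u$). For a connected graph $H$, the Wiener index is $W(H)=\sum_{\{u,v\}}d_H(u,v)$, the sum of graph distances over all unordered pairs of vertices. *)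

(* Defs.v *)
From mathcomp Require Import all_boot all_order all_algebra.
Set Implicit Arguments. Unset Strict Implicit. Unset Printing Implicit Defensive.

Fixpoint edge_act (T : eqType) (e : T * T) (w : seq T) : seq T :=
  match w with
  | [::] => [::]
  | x :: w' =>
      if x == e.1 then e.2 :: edge_act e w'
      else if x == e.2 then e.1 :: w'
      else x :: w'
  end.

Definition tree_adj (T : finType) (E : seq (T * T)) : rel T :=
  fun x y => ((x, y) \in E) || ((y, x) \in E).

Definition oriented_tree (T : finType) (E : seq (T * T)) : Prop :=
  [/\ all (fun e => e.1 != e.2) E,
      uniq E,
      all (fun e => (e.2, e.1) \notin E) E,
      (forall x y : T, connect (tree_adj E) x y) &
      ~ (exists (x : T) (p : seq T),
           [/\ 2 <= size p, uniq (x :: p), path (tree_adj E) x p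
             & tree_adj E (last x p) x])].

(* Schreier graph Gamma_n: vertices are words of length n; u and v are
   adjacent iff v = e(u) or u = e(v) for some oriented edge e (loops and
   multiple edges do not affect distances). *)
Definition schreier_adj (T : finType) (E : seq (T * T)) (n : nat) :
  rel (n.-tuple T) :=
  fun u v => has (fun e => (edge_act e u == val v) || (edge_act e v == val u)) E.

Arguments schreier_adj {T} E n.

(* Graph distance: the least m such that there is a path of length m from x
   to y (searched in 0 .. #|V|-1, which suffices in a connected graph). *)
Definition gdist (V : finType) (adj : rel V) (x y : V) : nat :=
  find (fun m => [exists p : m.-tuple V, path adj x p && (last x p == y)])
       (iota 0 #|V|).

Definition connected_graph (V : finType) (adj : rel V) : Prop :=
  forall x y : V, connect adj x y.

(* Wiener index: sum of distances over unordered pairs {u,v}, u <> v,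
   i.e. half the sum over ordered pairs (d(u,u) = 0). *)
Definition wiener (V : finType) (adj : rel V) : rat :=
  ((\sum_(u : V) \sum_(v : V) gdist adj u v)%N)%:R / 2.

(* Main.v *)
Require Import Defs.
From mathcomp Require Import all_boot all_order all_algebra.
From mathcomp Require Import zify ring lra.
Set Implicit Arguments. Unset Strict Implicit. Unset Printing Implicit Defensive.
Import GRing.Theory Num.Theory.

(** The Schreier graph is a cactus: every cycle of length [2^j] with label
    [e = (s, t)] lives on the words [{s,t}^j v] with [v] a fixed suffix not
    starting in [s] or [t]. Hence the distance of two words is the sum, over all
    cycles, of the distance of their projections to the cycle. Reading words from
    the last letter, [Gamma_(n+1)] consists of one copy of [Gamma_n] per vertex
    [x] of the tree, in which the [e]-cycles [{s,t}^n] with [x] in [e] are opened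
    and merged, two by two, into the [e]-cycles [{s,t}^(n+1)]. That the resulting
    recursive expression is the graph distance follows because it changes by at
    most one along edges and can always be decreased by one. Its sum satisfies
    linear recurrences: on a doubled cycle of length [2m] a point and its antipode
    are at total distance [m] from any third point, so the contributions of the
    long cycles only involve the sizes of the two sides of [e], and the sum of the
    products of these sizes is the Wiener index of the tree. *)

(** * Recognising the graph distance *)

Section GraphDistance.
Variables (V : finType) (adj : rel V) (d : V -> V -> nat).
Hypothesis d_refl : forall x, d x x = 0.
Hypothesis d_lip : forall x x' y, adj x x' -> d x y <= (d x' y).+1.
Hypothesis d_descent : forall x y, x != y ->
  exists2 x', adj x x' & d x y = (d x' y).+1.

Lemma dist_eq0 x y : d x y = 0 -> x = y.
Proof.
by move=> dxy; apply/eqP; apply/idPn => /d_descent[x' _]; rewrite dxy.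
Qed.

Lemma dist_path x y :
  exists p, [/\ path adj x p, last x p = y & size p = d x y].
Proof.
move: {2}(d x y) (erefl (d x y)) => m; elim: m x => [|m IHm] x dxy.
  by exists [::]; split; rewrite // (dist_eq0 dxy).
have /d_descent[x' xx' dx'] : x != y.
  by apply/eqP=> xy; rewrite xy d_refl in dxy.
have [|p [pp lp sp]] := IHm x'; first by move: dx'; rewrite dxy => -[].
by exists (x' :: p); rewrite /= xx' pp lp sp dx'.
Qed.

Lemma dist_le_path x p : path adj x p -> d x (last x p) <= size p.
Proof.
elim: p x => [|z p IHp] x /=; first by rewrite d_refl.
by move=> /andP[xz /IHp le]; apply: leq_trans (d_lip _ xz) _.
Qed.

Lemma dist_connected : connected_graph adj.
Proof.
by move=> x y; have [p [pp lp _]] := dist_path x y; apply/connectP; exists p.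
Qed.

(** Descent produces a path of length [d x y], and the Lipschitz bound forbids a shorter one. *)
Lemma gdistE x y : gdist adj x y = d x y.
Proof.
(* [find] only searches lengths below [#|V|]; a repetition-free path shows that [d x y] is among
   them. *)
have dlt : d x y < #|V|.
  have [p pp ->] := connectP (dist_connected x y).
  have [p' pp' up' _] := shortenP pp.
  apply: leq_ltn_trans (dist_le_path pp') _.
  by have := max_card (mem (x :: p')); rewrite (card_uniqP up').
rewrite /gdist; set P := (X in find X).
have Pd : P (d x y).
  have [p [pp lp sp]] := dist_path x y.
  apply/existsP; exists (Tuple (introT eqP sp)) => /=.
  by rewrite pp lp eqxx.
have Plt m : P m -> d x y <= m.
  case/existsP=> p /andP[pp /eqP <-].
  by rewrite (leq_trans (dist_le_path pp)) // size_tuple.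
have hasP : has P (iota 0 #|V|) by apply/hasP; exists (d x y); rewrite // mem_iota.
have := nth_find 0 hasP; rewrite nth_iota; last by move: hasP; rewrite has_find size_iota.
move=> /Plt le1; apply/eqP; rewrite eqn_leq le1 andbT leqNgt.
by apply/negP => /(before_find 0); rewrite nth_iota // Pd.
Qed.

End GraphDistance.

(** * Edges of a tree and the sides they separate *)

Section TreeSides.
Variables (T : finType) (E : seq (T * T)).

Definition side (e : T * T) (x : T) : bool :=
  connect (tree_adj (filter (predC1 e) E)) e.1 x.

Definition on_edge (e : T * T) (x : T) : bool := (x == e.1) || (x == e.2).

(** In a tree the geodesic crosses exactly the edges that separate its endpoints. *)
Definition tree_dist (x y : T) : nat :=
  \sum_(e <- E) (side e x != side e y).

Lemma tree_adj_sym (F : seq (T * T)) : symmetric (tree_adj F).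
Proof. by move=> x y; rewrite /tree_adj orbC. Qed.

Lemma tree_adj_connect_sym (F : seq (T * T)) : connect_sym (tree_adj F).
Proof. exact/sym_connect_sym/tree_adj_sym. Qed.

Lemma side1 e : side e e.1.
Proof. exact: connect0. Qed.

Lemma on_edge1 e : on_edge e e.1.
Proof. by rewrite /on_edge eqxx. Qed.

Lemma on_edge2 e : on_edge e e.2.
Proof. by rewrite /on_edge eqxx orbT. Qed.

Lemma side_adj e x y : tree_adj (filter (predC1 e) E) x y -> side e x = side e y.
Proof.
move=> xy; apply: (same_connect_r (tree_adj_connect_sym _)).
exact: connect1.
Qed.

Lemma side_edge e f : f \in E -> f != e -> side e f.1 = side e f.2.
Proof.
move=> fE fe; apply: side_adj; apply/orP; left.
by rewrite mem_filter -surjective_pairing /= fe.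
Qed.

Lemma side_on e f x y : f \in E -> f != e -> on_edge f x -> on_edge f y ->
  side e x = side e y.
Proof.
by move=> fE fe /orP[]/eqP-> /orP[]/eqP->; rewrite ?(side_edge fE fe).
Qed.

Hypothesis treeE : oriented_tree E.

Lemma tree_edge_neq e : e \in E -> e.1 != e.2.
Proof. by case: treeE => /allP h _ _ _ _; apply: h. Qed.

Lemma tree_uniq : uniq E.
Proof. by case: treeE. Qed.

(** A simple path from [e.1] to [e.2] avoiding [e] would close up with [e] to a cycle. *)
Lemma side2 e : e \in E -> side e e.2 = false.
Proof.
move=> eE; have [_ _ /allP anti _ acyc] := treeE.
apply/negP => /connectP[p0 pp0 e2]; apply: acyc.
move: e2; have [p pp up _] := shortenP pp0 => e2.
exists e.1, p; split=> //.
(* A cycle needs two edges besides [e]: a single one could only be the reverse of [e], which is not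
   in [E]. *)
- case: p pp up e2 => [|z [|z' p]] //= + _ e2.
    by move=> _; have := tree_edge_neq eE; rewrite e2 eqxx.
  rewrite andbT -e2 /tree_adj !mem_filter /= -surjective_pairing eqxx /=.
  by rewrite (negPf (anti _ eE)) andbF.
- apply: sub_path pp => x y; rewrite /tree_adj !mem_filter.
  by case/orP=> /andP[_ ->]; rewrite ?orbT.
- by rewrite -e2 /tree_adj -surjective_pairing eE orbT.
Qed.

Lemma side_onE e x : e \in E -> on_edge e x -> side e x = (x == e.1).
Proof.
move=> eE /orP[]/eqP->; first by rewrite side1 eqxx.
by rewrite side2 // eq_sym (negPf (tree_edge_neq eE)).
Qed.

(** Take for [e] the first edge of a simple path from [x] to [y]: the rest of the path avoids [x],
    hence [e], and stays on one side. *)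
Lemma side_first_edge x y : x != y ->
  exists e z, [/\ e \in E, on_edge e x, on_edge e z, side e x != side e z
    & side e z = side e y].
Proof.
move=> xy; have [_ _ _ conn _] := treeE.
have [p0 pp0 y0] := connectP (conn x y).
move: y0; case: (shortenP pp0) => p pp up _ yE {p0 pp0}.
case: p pp up yE => [|z p] /=; first by move=> _ _ /eqP; rewrite eq_sym (negPf xy).
move=> /andP[xz pp] /andP[xzp up] yE.
have [e eE [ex ez]] : exists2 e, e \in E & on_edge e x /\ on_edge e z.
  by case/orP: xz => ?; [exists (x, z)|exists (z, x)]; rewrite // /on_edge /= !eqxx ?orbT.
have xnz : x != z by move: xzp; rewrite inE negb_or => /andP[].
exists e, z; split=> //.
  rewrite !side_onE //.
  have := tree_edge_neq eE.
  by case/orP: ex xnz => /eqP->; case/orP: ez => /eqP->;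
    rewrite ?eqxx // [e.2 == e.1]eq_sym => _ /negPf->.
have avoid a b : a != x -> b != x -> tree_adj E a b ->
    tree_adj (filter (predC1 e) E) a b.
  rewrite /tree_adj !mem_filter /= => ax bx.
  have ne u v : u != x -> v != x -> ((u, v) == e) = false.
    move=> ux vx; apply/eqP=> ue; move: ex; rewrite -ue /on_edge /=.
    by rewrite eq_sym (negPf ux) eq_sym (negPf vx).
  by rewrite !ne.
rewrite yE; elim: p z {xz ez xnz yE} pp xzp up => [|b p IHp] z //=.
move=> /andP[zb pp]; rewrite !inE !negb_or => /and3P[xz xb xp] /andP[_ up].
rewrite -(IHp b) ?inE ?negb_or ?xb //; apply: side_adj.
by apply: avoid; rewrite // eq_sym.
Qed.

Lemma tree_dist_xx x : tree_dist x x = 0.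
Proof. by rewrite /tree_dist big1 // => e _; rewrite eqxx. Qed.

(** No edge but [e] separates the ends of [e]. The additive form avoids truncated subtraction. *)
Lemma tree_dist_step e x x' y : e \in E -> on_edge e x -> on_edge e x' ->
  tree_dist x y + (side e x' != side e y) = tree_dist x' y + (side e x != side e y).
Proof.
move=> eE ex ex'; rewrite /tree_dist !(bigD1_seq e eE tree_uniq) /=.
rewrite (eq_bigr (fun f => side f x' != side f y : nat)) => [|f fe]; first lia.
by rewrite (side_on eE _ ex ex') // eq_sym.
Qed.

Lemma adj_on_edge x y : tree_adj E x y ->
  exists2 e, e \in E & on_edge e x /\ on_edge e y.
Proof.
by case/orP=> ?; [exists (x, y)|exists (y, x)]; rewrite // /on_edge /= !eqxx ?orbT.
Qed.

Lemma on_edge_adj e x y : e \in E -> on_edge e x -> on_edge e y -> x != y ->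
  tree_adj E x y.
Proof.
case: e => a b eE /orP[]/eqP-> /orP[]/eqP->; rewrite ?eqxx //= /tree_adj eE //.
by rewrite orbT.
Qed.

Lemma tree_dist_lip x x' y : tree_adj E x x' -> tree_dist x y <= (tree_dist x' y).+1.
Proof.
by case/adj_on_edge=> e eE [ex ex']; have := tree_dist_step y eE ex ex'; lia.
Qed.

Lemma tree_dist_descent x y : x != y ->
  exists2 x', tree_adj E x x' & tree_dist x y = (tree_dist x' y).+1.
Proof.
case/side_first_edge=> e [z [eE ex ez xz zy]]; exists z.
  by apply: (on_edge_adj eE ex ez); apply: contraNneq xz => ->.
by have := tree_dist_step y eE ex ez; rewrite -zy eqxx xz; lia.
Qed.

Lemma tree_gdistE x y : gdist (tree_adj E) x y = tree_dist x y.
Proof.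
exact: (gdistE tree_dist_xx tree_dist_lip tree_dist_descent).
Qed.

(* Rooting the tree at r, each edge owns its endpoint away from r, and each
   vertex other than r is owned by exactly one edge. *)
Lemma side_owner_unique r c e f : e \in E -> f \in E -> on_edge e c -> on_edge f c ->
  side e r != side e c -> side f r != side f c -> e = f.
Proof.
move=> eE fE ec fc re rf; apply/eqP/idPn => ef.
have fe : f != e by rewrite eq_sym.
have [_ _ _ conn _] := treeE.
(* As [c] is on both edges, no end of [e] or [f] lies in [A]; so no edge leaves [A], and
   connectedness would put [c] into it. *)
pose A := [pred x | (side e x == side e r) && (side f x == side f r)].
have Acl x y : A x -> tree_adj E x y -> A y.
  move=> /andP[/eqP xe /eqP xf] /adj_on_edge[g gE [gx gy]].
  have [ge|ge] := eqVneq g e.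
    subst g; have fxy : side f x = side f y by apply: side_on gx gy.
    have fxc : side f x = side f c by apply: side_on gx ec.
    by move: rf; rewrite -xf fxc eqxx.
  have [gf|gf] := eqVneq g f.
    subst g; have exc : side e x = side e c by apply: side_on gx fc.
    by move: re; rewrite -xe exc eqxx.
  apply/andP; rewrite -(side_on gE ge gx gy) -(side_on gE gf gx gy).
  by rewrite xe xf !eqxx.
have Alast p x : path (tree_adj E) x p -> A x -> A (last x p).
  by elim: p x => //= y p IHp x /andP[xy /IHp yp] /Acl/(_ xy).
have [p pp cE] := connectP (conn r c).
have /andP[/eqP ce _] : A c by rewrite cE; apply: Alast; rewrite //= !eqxx.
by rewrite ce eqxx in re.
Qed.

Lemma size_tree : 0 < #|T| -> (size E).+1 = #|T|.
Proof.
move=> T_gt0; have /card_gt0P[r _] := T_gt0.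
have <- : \sum_(e <- E) 1 = size E by rewrite sum1_size.
rewrite (eq_big_seq (fun e => \sum_(x : T) (on_edge e x && (side e r != side e x)))).
  rewrite exchange_big (bigD1 r) //= big1 ?add0n; last by move=> e _; rewrite eqxx andbF.
  rewrite -(prednK T_gt0) -(cardC1 r) -sum1_card; congr _.+1.
  apply: eq_big => x; rewrite ?inE // => xr.
  have [e [z [eE ex ez xz zr]]] := side_first_edge xr.
  rewrite (bigD1_seq e eE tree_uniq) /= ex -zr eq_sym xz big1_seq // => f /andP[fe fE].
  case: andP => // -[fx rx]; case/eqP: fe.
  by apply: (side_owner_unique fE eE fx ex rx); rewrite -zr eq_sym.
move=> e eE; rewrite (bigD1 e.1) //= (bigD1 e.2) /=; last by rewrite eq_sym tree_edge_neq.
rewrite big1 => [|x /andP[x1 x2]]; last by rewrite /on_edge (negPf x1) (negPf x2).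
by rewrite on_edge1 on_edge2 side1 side2 //; case: (side e r).
Qed.

End TreeSides.

(** * Distance on a cycle *)

(** With truncated subtraction, [p - q + (q - p)] is the absolute difference. *)
Definition cycle_dist (M p q : nat) : nat := minn (p - q + (q - p)) (M - (p - q + (q - p))).

Lemma cycle_distC M : commutative (cycle_dist M).
Proof. by move=> p q; rewrite /cycle_dist addnC. Qed.

Lemma cycle_distxx M p : cycle_dist M p p = 0.
Proof. by rewrite /cycle_dist subnn min0n. Qed.

Definition cycle_pred (M p : nat) : nat := if p == 0 then M.-1 else p.-1.

Lemma cycle_dist_lip M p q : p < M -> q < M ->
  cycle_dist M p q <= (cycle_dist M (cycle_pred M p) q).+1 /\
  cycle_dist M (cycle_pred M p) q <= (cycle_dist M p q).+1.
Proof. rewrite /cycle_dist /cycle_pred; case: ifP; lia. Qed.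

(** The shorter arc to [q] leaves [p] through its predecessor or its successor [p'], which is
    described through its own predecessor. *)
Lemma cycle_dist_descent M p q p' : p < M -> q < M -> p' < M -> p != q ->
  cycle_pred M p' = p ->
  cycle_dist M p q = (cycle_dist M (cycle_pred M p) q).+1 \/
  cycle_dist M p q = (cycle_dist M p' q).+1.
Proof.
rewrite /cycle_dist /cycle_pred => pM qM p'M; case: (ltngtP p q) => // pq _.
  have [near|far] := leqP (2 * (q - p)) M; case: (eqVneq p' 0) => p'0 p'E.
  - by left; case: eqP; lia.
  - by right; lia.
  - by left; case: eqP; lia.
  - by left; case: eqP; lia.
have [near|far] := leqP (2 * (p - q)) M; case: (eqVneq p' 0) => p'0 p'E.
- by left; case: eqP; lia.
- by left; case: eqP; lia.
- by right; lia.
- by right; lia.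
Qed.

(** The point [q] lies on one of the two arcs joining [p] to its antipode, and both arcs are
    geodesics of length [m]. *)
Lemma cycle_dist_half m p q : p < m -> q < 2 * m ->
  cycle_dist (2 * m) p q + cycle_dist (2 * m) (m + p) q = m.
Proof. rewrite /cycle_dist; lia. Qed.

(** * The action on reversed words and the positions on cycles *)

Section Words.
Variables (T : finType) (E : seq (T * T)).
Implicit Types (e f : T * T) (x y z : T) (r u v w : seq T).
Local Notation side := (side E).

Definition flip e x := if x == e.1 then e.2 else if x == e.2 then e.1 else x.

(* [edge_act e] on reversed words: the head is the last letter of the word, which
   is reached by the carry exactly when all the letters before it are [e.1]. *)
Fixpoint ract e r :=
  if r is x :: r' then (if all (pred1 e.1) r' then flip e x else x) :: ract e r'
  else [::].

Lemma edge_act_rcons e u x : edge_act e (rcons u x) =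
  rcons (edge_act e u) (if all (pred1 e.1) u then flip e x else x).
Proof.
elim: u => [|a u IHu] /=; first by rewrite /flip; do 2?case: ifP.
by case: eqP => // _; rewrite ?IHu //; case: ifP.
Qed.

Lemma edge_act_rev e r : edge_act e (rev r) = rev (ract e r).
Proof.
by elim: r => //= x r IHr; rewrite !rev_cons edge_act_rcons all_rev IHr.
Qed.

Lemma edge_actK e : e.1 != e.2 -> cancel (edge_act (e.2, e.1)) (edge_act e).
Proof.
move=> e12; elim=> //= x w IHw.
have [->|x2] := eqVneq x e.2; first by rewrite /= eqxx IHw.
have [->|x1] := eqVneq x e.1; last by rewrite /= (negPf x1) (negPf x2).
by rewrite /= eq_sym (negPf e12) eqxx.
Qed.

Lemma size_ract e r : size (ract e r) = size r.
Proof. by elim: r => //= x r ->. Qed.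

(** The reversed edge acts inversely; this supplies the second neighbour on an [e]-cycle. *)
Lemma ract_surj e r : e.1 != e.2 -> exists2 r', r = ract e r' & size r' = size r.
Proof.
move=> e12; pose r' := ract (e.2, e.1) r; exists r'; last exact: size_ract.
by apply: (can_inj revK); rewrite -edge_act_rev -edge_act_rev edge_actK.
Qed.

Lemma flip1 e : flip e e.1 = e.2.
Proof. by rewrite /flip eqxx. Qed.

Lemma flip2 e : e.1 != e.2 -> flip e e.2 = e.1.
Proof. by rewrite /flip eqxx eq_sym => /negPf->. Qed.

Lemma ract_nseq e n : ract e (nseq n e.1) = nseq n e.2.
Proof.
elim: n => //= n ->; rewrite /flip eqxx.
by case: ifP => //; rewrite all_nseq /= eqxx orbT.
Qed.

Lemma on_edge_flip e x : on_edge e (flip e x) = on_edge e x.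
Proof.
rewrite /flip; case: eqP => [->|/eqP x1]; first by rewrite on_edge1 on_edge2.
by case: eqP => [->|//]; rewrite on_edge1 on_edge2.
Qed.

Lemma flip_id e x : ~~ on_edge e x -> flip e x = x.
Proof. by rewrite /flip negb_or => /andP[/negPf-> /negPf->]. Qed.

(** For an edge [e], the full words of a given length form a single orbit, the longest [e]-cycle. *)
Definition full e r := all (on_edge e) r.

Lemma full_ract e r : full e (ract e r) = full e r.
Proof. by elim: r => //= x r ->; case: ifP; rewrite ?on_edge_flip. Qed.

Lemma all1_nseq e r : all (pred1 e.1) r -> r = nseq (size r) e.1.
Proof. by move/all_pred1P. Qed.

Lemma all1_full e r : all (pred1 e.1) r -> full e r.
Proof. by apply: sub_all => x /eqP->; rewrite on_edge1. Qed.

(** Position of the constant word in [e.1] ([b] true) or in [e.2] ([b] false). The two are adjacent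
    on the cycle, since [e] sends the first word to the second. *)
Definition end_pos n (b : bool) := ~~ b * (2 ^ n).-1.

(* Position, on the e-cycle through the words over the ends of e, of the
   projection of a word: a letter off e moves everything before it to the end of
   its side of e. The action of e decrements the position, reading [e.1] as digit
   0 and [e.2] as digit 1. *)
Fixpoint pos e r : nat :=
  if r is x :: r' then
    if on_edge e x then ~~ side e x * 2 ^ size r' + pos e r'
    else end_pos (size r').+1 (side e x)
  else 0.

Lemma pos_lt e r : pos e r < 2 ^ size r.
Proof.
elim: r => //= x r IHr; rewrite expnS /end_pos expnS.
by have := expn_gt0 2 (size r); case: ifP => _; case: (side e x) => /=; lia.
Qed.

Lemma pos_nseq e n z : pos e (nseq n z) = end_pos n (side e z).
Proof.
elim: n => [|n IHn] /=; first by rewrite /end_pos muln0.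
rewrite size_nseq; case: ifP => // _; rewrite IHn /end_pos expnS.
by have := expn_gt0 2 n; case: (side e z) => /=; lia.
Qed.

Lemma pos_cons_nseq e n x z : side e z = side e x ->
  pos e (x :: nseq n z) = end_pos n.+1 (side e x).
Proof.
move=> zx; rewrite -(pos_nseq e n.+1 x) /= !size_nseq.
by rewrite !pos_nseq zx.
Qed.

Hypothesis treeE : oriented_tree E.

(** Both ends of [e] are on the same side of [f]. Where the carry arrives, the word lies entirely on
    that side before and after the step, so its position stays at the same end. *)
Lemma pos_ract_other e f r : e \in E -> f \in E -> f != e ->
  pos f (ract e r) = pos f r.
Proof.
move=> eE fE fe; elim: r => //= x r IHr.
have [/all1_nseq r1|_] := boolP (all _ r); last by rewrite size_ract IHr.
have [ex|/flip_id ->] := boolP (on_edge e x); last by rewrite size_ract IHr.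
rewrite r1 ract_nseq -[LHS]/(pos f (_ :: _)) -[RHS]/(pos f (_ :: _)).
rewrite !pos_cons_nseq; first congr end_pos; apply: (side_on eE);
  by rewrite ?on_edge_flip ?on_edge1 ?on_edge2 // eq_sym.
Qed.

(** In reading order, the action changes only letters before the first letter off [e], while [pos]
    ignores all letters before the last such letter. *)
Lemma pos_ract_notfull e r : ~~ full e r -> pos e (ract e r) = pos e r.
Proof.
elim: r => //= x r IHr; have [ex|ex] := boolP (on_edge e x) => /= [fr|_].
  by rewrite (contraNF (@all1_full e r)) // ex size_ract IHr.
by rewrite flip_id // if_same (negPf ex) size_ract.
Qed.

Lemma on_edge_inj e x z : e \in E -> on_edge e x -> on_edge e z ->
  side e x = side e z -> x = z.
Proof.
move=> eE ex ez; rewrite !side_onE //.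
have e12 := tree_edge_neq treeE eE.
by case/orP: ex => /eqP->; case/orP: ez => /eqP->; rewrite ?eqxx // eq_sym (negPf e12).
Qed.

Lemma full_pos_end e r z : e \in E -> on_edge e z -> full e r ->
  pos e r = end_pos (size r) (side e z) -> r = nseq (size r) z.
Proof.
move=> eE ez; elim: r => //= x r IHr /andP[ex fr]; rewrite ex.
move=> pE; have ltr := pos_lt e r.
have [xz rE] : side e x = side e z /\ pos e r = end_pos (size r) (side e z).
  move: pE ltr; rewrite /end_pos expnS; move: (2 ^ _) (pos e r) => M p.
  case: (side e x); case: (side e z) => /= ? ?; (split; [by [] | lia]) || (exfalso; lia).
by rewrite (on_edge_inj eE ex ez xz) {1}(IHr fr rE).
Qed.

Lemma pos_ract_full e r : e \in E -> full e r ->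
  pos e (ract e r) = cycle_pred (2 ^ size r) (pos e r).
Proof.
move=> eE; elim: r => //= x r IHr /andP[ex fr].
have n0 := expn_gt0 2 (size r).
have [r1|r1] := boolP (all _ r); last first.
  rewrite ex size_ract IHr // /cycle_pred.
  case: eqP => [r0|r0].
    (* Position 0 would make the tail constant [e.1]; so the borrow does not reach the top digit. *)
    by move: r1; rewrite (full_pos_end eE (on_edge1 e) fr) ?side1 // all_nseq /= eqxx orbT.
  by case: eqP; lia.
rewrite on_edge_flip ex size_ract (side_onE treeE eE ex) side_onE ?on_edge_flip //.
move/all1_nseq: r1 => ->; rewrite ract_nseq !pos_nseq side1 side2 // /end_pos.
rewrite !size_nseq /cycle_pred expnS; have e12 := tree_edge_neq treeE eE.
by case/orP: ex => /eqP->; rewrite ?flip1 ?flip2 // ?eqxx ?[e.2 == _]eq_sym ?(negPf e12) /=;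
  [lia | case: ifP; lia].
Qed.

End Words.

(** * The recursive distance on words *)

Section WordDistance.
Variables (T : finType) (E : seq (T * T)).
Implicit Types (e f : T * T) (x y z : T) (r u v w : seq T)
  (P : pred (T * T)).
Local Notation side := (side E).
Local Notation pos := (pos E).

Definition cycle_sum (P : pred (T * T)) u v :=
  \sum_(f <- E | P f) cycle_dist (2 ^ size u) (pos f u) (pos f v).

(* [inner_dist] collects the cycles of length less than [2 ^ size u]. In the copy
   of [x] these are its own short cycles, together with its longest cycles for
   the edges off [x], which are not opened. The path from copy [x] to another copy
   leaves at some constant word, and all constant words have the same projections
   to short cycles; [height] measures the way to them. *)
Definition off_edge x : pred (T * T) := fun e => ~~ on_edge e x.

Fixpoint height v :=
  if v is y :: r then height r + cycle_sum (off_edge y) (nseq (size r) y) r else 0.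

Fixpoint inner_dist u v :=
  match u, v with
  | x :: r, y :: r' =>
      if x == y then inner_dist r r' + cycle_sum (off_edge x) r r'
      else height u + height v
  | _, _ => 0
  end.

Definition word_dist u v := inner_dist u v + cycle_sum predT u v.

Definition copy_dist x r w := inner_dist r w + cycle_sum (off_edge x) r w.

Lemma cycle_sumC P u v : size u = size v -> cycle_sum P u v = cycle_sum P v u.
Proof.
by move=> uv; apply: eq_bigr => f _; rewrite uv cycle_distC.
Qed.

Lemma cycle_sumxx P u : cycle_sum P u u = 0.
Proof. by apply: big1 => f _; rewrite cycle_distxx. Qed.

Lemma eq_cycle_sum P u u' v : size u = size u' ->
  {in E, forall f, P f -> pos f u = pos f u'} -> cycle_sum P u v = cycle_sum P u' v.
Proof.
move=> su eqpos; rewrite /cycle_sum big_seq_cond [RHS]big_seq_cond.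
by apply: eq_bigr => f /andP[fE Pf]; rewrite su eqpos.
Qed.

Lemma inner_distC u v : size u = size v -> inner_dist u v = inner_dist v u.
Proof.
elim: u v => [|x r IHr] [|y r'] //= [sr].
rewrite eq_sym; case: eqP => [->|_]; first by rewrite IHr // cycle_sumC.
by rewrite addnC.
Qed.

(** The value does not depend on [z], so one height per word serves all exits from its copy. *)
Lemma inner_dist_nseq z v : inner_dist (nseq (size v) z) v = height v.
Proof.
have h0 n : height (nseq n z) = 0.
  by elim: n => //= n ->; rewrite size_nseq cycle_sumxx.
elim: v => //= y r IHr; have [<-|_] := eqVneq z y; first by rewrite IHr.
by rewrite h0 size_nseq cycle_sumxx.
Qed.

Lemma inner_distxx u : inner_dist u u = 0.
Proof. by elim: u => //= x r ->; rewrite eqxx cycle_sumxx. Qed.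

Lemma copy_dist_nseq x r : copy_dist x (nseq (size r) x) r = height (x :: r).
Proof. by rewrite /copy_dist inner_dist_nseq. Qed.

Lemma copy_distC x r w : size r = size w -> copy_dist x r w = copy_dist x w r.
Proof. by move=> srw; rewrite /copy_dist inner_distC // cycle_sumC. Qed.

Lemma copy_distxx x r : copy_dist x r r = 0.
Proof. by rewrite /copy_dist inner_distxx cycle_sumxx. Qed.

Lemma height_copy x r : height (x :: r) = copy_dist x r (nseq (size r) x).
Proof. by rewrite -copy_dist_nseq copy_distC // size_nseq. Qed.

Lemma inner_dist_cons x r y r' : size r = size r' ->
  inner_dist (x :: r) (y :: r') =
    if x == y then copy_dist x r r'
    else copy_dist x r (nseq (size r) x) + height (y :: r').
Proof. by move=> srr; rewrite -height_copy /=; case: eqP => // ->. Qed.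

Hypothesis treeE : oriented_tree E.

Lemma cycle_sum_step P e u u' v : e \in E -> size u = size u' ->
  {in E, forall f, f != e -> pos f u = pos f u'} ->
  cycle_sum P u v + P e * cycle_dist (2 ^ size u) (pos e u') (pos e v) =
  cycle_sum P u' v + P e * cycle_dist (2 ^ size u) (pos e u) (pos e v).
Proof.
move=> eE su same; rewrite /cycle_sum !(big_mkcond P) /=.
rewrite !(bigD1_seq e eE (tree_uniq treeE)) /= -su.
set S := \sum_(f <- E | f != e) _; set S' := \sum_(f <- E | f != e) _.
have -> : S = S'.
  rewrite /S /S' big_seq_cond [RHS]big_seq_cond.
  by apply: eq_bigr => f /andP[fE fe]; rewrite same.
by case: (P e); lia.
Qed.

Definition neighbour e u u' := u' = ract e u \/ u = ract e u'.

Lemma neighbour_size e u u' : neighbour e u u' -> size u' = size u.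
Proof. by case=> ->; rewrite size_ract. Qed.

Lemma neighbour_pos_other e f u u' : e \in E -> neighbour e u u' -> f \in E -> f != e ->
  pos f u' = pos f u.
Proof. by move=> eE uu' fE fe; case: uu' => ->; rewrite (pos_ract_other). Qed.

Lemma cycle_sum_neighbour P e u u' v : e \in E -> neighbour e u u' ->
  cycle_sum P u v + P e * cycle_dist (2 ^ size u) (pos e u') (pos e v) =
  cycle_sum P u' v + P e * cycle_dist (2 ^ size u) (pos e u) (pos e v).
Proof.
move=> eE uu'; apply: cycle_sum_step => // [|f fE fe].
  by rewrite (neighbour_size uu').
by rewrite (neighbour_pos_other eE uu').
Qed.

(** The edges counted are off [x], hence differ from [e] and do not separate [x] from [z]. *)
Lemma copy_dist_ends e x z w : e \in E -> on_edge e x -> on_edge e z ->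
  copy_dist x (nseq (size w) z) w = height (x :: w).
Proof.
move=> eE ex ez; rewrite -copy_dist_nseq /copy_dist !inner_dist_nseq; congr (_ + _).
apply: eq_cycle_sum => [|f fE fx]; first by rewrite !size_nseq.
rewrite !pos_nseq (side_on eE _ ez ex) //.
by apply: contraNneq fx => <-.
Qed.

(* The word [z ... z x] with x, z in e lies on the longest e-cycle, so, as for
   constant words, its inner distance to v only depends on v. *)
Lemma inner_dist_ends e x z v : e \in E -> on_edge e x -> on_edge e z ->
  size v = (size v).-1.+1 ->
  inner_dist (x :: nseq (size v).-1 z) v = height v.
Proof.
case: v => // y r eE ex ez _; rewrite inner_dist_cons ?size_nseq //.
case: eqP => [<-|_]; first exact: (copy_dist_ends r eE ex ez).
have := copy_dist_ends (nseq (size r) x) eE ex ez; rewrite size_nseq => ->.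
by rewrite height_copy size_nseq copy_distxx.
Qed.

Lemma inner_dist_ract e u v : e \in E -> size u = size v ->
  if full e u then inner_dist (ract e u) v = inner_dist u v
  else inner_dist u v <= (inner_dist (ract e u) v).+1 /\
       inner_dist (ract e u) v <= (inner_dist u v).+1.
Proof.
move=> eE; elim: u v => [|x r IHr] [|y r'] // [sr].
have copy_step w : size r = size w ->
    if full e (x :: r) then copy_dist x (ract e r) w = copy_dist x r w
    else copy_dist x r w <= (copy_dist x (ract e r) w).+1 /\
         copy_dist x (ract e r) w <= (copy_dist x r w).+1.
  move=> sw; rewrite /copy_dist /=; have := IHr w sw.
  have := cycle_sum_neighbour (off_edge x) w eE (or_introl (erefl (ract e r))).
  rewrite -[off_edge x e]/(~~ on_edge e x); case fr: (full e r); last first.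
    rewrite andbF pos_ract_notfull ?fr //; lia.
  (* On a full tail the step follows the longest [e]-cycle of the copy, which is counted here
     exactly when [x] is off [e]. *)
  rewrite andbT; have [_ /= | _ /=] := boolP (on_edge e x); first lia.
  have := cycle_dist_lip (q := pos e w) (pos_lt E e r).
  rewrite (pos_ract_full treeE eE fr) sw => /(_ (pos_lt E e w)); lia.
(* In this case the carry flips [x] and the step changes copies, between two words covered by
   [inner_dist_ends]. *)
have [|nends] := boolP (on_edge e x && all (pred1 e.1) r).
  case/andP=> ex /[dup] /all1_full fr r1.
  rewrite [full _ _]/= ex fr /= r1 (all1_nseq r1) ract_nseq.
  rewrite -/(inner_dist (_ :: _) (y :: r')) -/(inner_dist (x :: _) (y :: r')).
  have sr' : size r = (size (y :: r')).-1 by [].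
  by rewrite sr' !(inner_dist_ends eE) ?on_edge_flip ?on_edge1 ?on_edge2.
have -> : ract e (x :: r) = x :: ract e r.
  rewrite /=; case: ifP => // r1; rewrite flip_id //.
  by move: nends; rewrite r1 andbT.
rewrite !inner_dist_cons ?size_ract //.
case: eqP => _; first exact: copy_step.
have := copy_step (nseq (size r) x); rewrite size_nseq => /(_ erefl).
by case: ifP; lia.
Qed.

Lemma word_distxx u : word_dist u u = 0.
Proof. by rewrite /word_dist inner_distxx cycle_sumxx. Qed.

(** At most one summand changes: the cycle sum if [u] is full for [e], the inner distance
    otherwise. *)
Lemma word_dist_ract e u v : e \in E -> size u = size v ->
  word_dist u v <= (word_dist (ract e u) v).+1 /\
  word_dist (ract e u) v <= (word_dist u v).+1.
Proof.
move=> eE suv; have := inner_dist_ract eE suv; rewrite /word_dist.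
have := cycle_sum_neighbour predT v eE (or_introl (erefl (ract e u))).
case: ifP => fu /=; last by rewrite pos_ract_notfull ?fu //; lia.
have := cycle_dist_lip (q := pos e v) (pos_lt E e u).
rewrite (pos_ract_full treeE eE fu) suv => /(_ (pos_lt E e v)); lia.
Qed.

Lemma neighbour_pos_notfull e f u u' : e \in E -> neighbour e u u' -> ~~ full e u ->
  f \in E -> pos f u' = pos f u.
Proof.
move=> eE uu' fu fE; have [->|] := eqVneq f e; last exact: neighbour_pos_other uu' fE.
case: uu' fu => -> fu; first by rewrite pos_ract_notfull.
by rewrite full_ract in fu; rewrite pos_ract_notfull.
Qed.

(* A neighbour along e in a copy lifts to the whole graph, unless it uses the
   edge where the e-cycle of the copy is opened. *)
Lemma neighbour_cons e x u u' : ~~ full e u || ~~ on_edge e x -> neighbour e u u' ->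
  neighbour e (x :: u) (x :: u').
Proof.
have lift v : ~~ full e v || ~~ on_edge e x -> ract e (x :: v) = x :: ract e v.
  move=> h /=; case: ifP => // /all1_full fv.
  by rewrite fv in h; rewrite flip_id.
move=> h [uu'|uu']; [left|right]; rewrite lift ?uu' //.
by rewrite -(full_ract e) -uu'.
Qed.

Lemma cycle_neighbour e u v : e \in E -> full e u -> size u = size v ->
  pos e u != pos e v ->
  exists2 u', neighbour e u u' &
    cycle_dist (2 ^ size u) (pos e u) (pos e v) =
    (cycle_dist (2 ^ size u) (pos e u') (pos e v)).+1.
Proof.
move=> eE fu suv puv.
have [u0 u0E su0] := ract_surj u (tree_edge_neq treeE eE).
have fu0 : full e u0 by rewrite -(full_ract e) -u0E.
have pv : pos e v < 2 ^ size u by rewrite suv pos_lt.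
have pu0 : pos e u0 < 2 ^ size u by rewrite -su0 pos_lt.
have := cycle_dist_descent (pos_lt E e u) pv pu0 puv.
rewrite -su0 -(pos_ract_full treeE eE fu0) -u0E su0 => /(_ erefl) [|] dE.
  by exists (ract e u); [left|rewrite (pos_ract_full treeE eE fu)].
by exists u0; [right|].
Qed.

Lemma neighbour_inner_dist e u u' v : e \in E -> full e u -> neighbour e u u' ->
  size u = size v -> inner_dist u' v = inner_dist u v.
Proof.
move=> eE fu [u'E|uE] suv; first by have := inner_dist_ract eE suv; rewrite fu u'E.
have := @inner_dist_ract e u' v eE; rewrite -suv -(full_ract e) uE size_ract => /(_ erefl).
by rewrite -uE fu.
Qed.

Definition inner_descent u v := exists e u',
  [/\ e \in E, ~~ full e u, neighbour e u u' & inner_dist u v = (inner_dist u' v).+1].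

(* Here a step along the longest e-cycle, which changes no other coordinate,
   brings u closer to v. *)
Definition outer_descent u v := exists e, [/\ e \in E, full e u & pos e u != pos e v].

(** A step on the longest [e]-cycle of the copy becomes an inner step when [x] is off [e], as this
    cycle stays closed; only for [x] on [e] does it remain outer. *)
Lemma copy_descent x r w : size r = size w ->
  inner_descent r w \/ outer_descent r w ->
  (exists e r', [/\ e \in E, ~~ full e (x :: r), neighbour e (x :: r) (x :: r')
     & copy_dist x r w = (copy_dist x r' w).+1]) \/
  (exists e, [/\ e \in E, full e (x :: r) & pos e r != pos e w]).
Proof.
move=> srw [[e [r' [eE fr rr' dE]]]|[e [eE fr pe]]].
  left; exists e, r'; split=> //=.
  - by rewrite negb_and fr orbT.
  - by apply: neighbour_cons; rewrite // fr.
  rewrite /copy_dist dE; congr (_ + _).+1; apply: eq_cycle_sum => [|f fE _].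
    by rewrite (neighbour_size rr').
  by rewrite (neighbour_pos_notfull eE rr').
have [ex|ex] := boolP (on_edge e x); first by right; exists e; rewrite /= ex.
have [r' rr' dE] := cycle_neighbour eE fr srw pe.
left; exists e, r'; split=> //=; first by rewrite negb_and ex.
  by apply: neighbour_cons; rewrite // ex orbT.
rewrite /copy_dist (neighbour_inner_dist eE fr rr' srw).
have := cycle_sum_neighbour (off_edge x) w eE rr'.
by rewrite -[off_edge x e]/(~~ on_edge e x) ex dE; lia.
Qed.

(** If [y] differs from [x], equal positions force [y] off [e]; the common position is then an end,
    reached by a full word only if it is constant. *)
Lemma pos_full_same e x r y r' : full e (x :: r) -> e \in E -> size r = size r' ->
  pos e (x :: r) = pos e (y :: r') -> side e x = side e y /\
  (x <> y -> r = nseq (size r) x).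
Proof.
move=> /andP[ex fr] eE sr; rewrite /= ex -sr.
have := pos_lt E e r; have := pos_lt E e r'; rewrite -sr.
have rend := full_pos_end treeE eE ex fr; rewrite /end_pos in rend.
have [ey|ey] := boolP (on_edge e y).
  have xy := on_edge_inj treeE eE ex ey; move: xy {rend}.
  move: (2 ^ _) (pos e r) (pos e r') => M p p'.
  case: (side e x); case: (side e y) => /= xy ? ? ?;
    (by split=> // /(_ (xy erefl))) || (exfalso; lia).
move: rend; rewrite /end_pos expnS; move: (2 ^ _) (pos e r) (pos e r') => M p p' rend ltp' ltp.
case: (side e x) rend; case: (side e y) => /= rend ?;
  (split=> // _; apply: rend; lia) || (exfalso; lia).
Qed.

Lemma word_descent u v : size u = size v -> u != v ->
  inner_descent u v \/ outer_descent u v.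
Proof.
elim: u v => [|x r IHr] [|y r'] // [sr] uv.
have [xy|xy] := eqVneq x y.
  subst y; have rr' : r != r' by apply: contraNneq uv => ->.
  have [[e [w [eE fr nb dE]]]|[e [eE fr pe]]] := copy_descent x sr (IHr r' sr rr').
    left; exists e, (x :: w); split=> //.
    have sw : size w = size r by have [] := neighbour_size nb.
    by rewrite !inner_dist_cons ?sw // eqxx.
  right; exists e; split=> //=; case/andP: fr => -> _.
  by rewrite sr eqn_add2l.
(* In different copies, the constant word in [x] is the exit: there, go along the first tree edge
   towards [y]; elsewhere, approach the exit within the copy. *)
have [rE|rx] := eqVneq r (nseq (size r) x).
  have [e [z [eE ex ez xz zy]]] := side_first_edge treeE xy.
  have fr : full e (x :: r) by rewrite rE /= ex /full all_nseq ex orbT.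
  right; exists e; split=> //; apply: contraNneq xz => pxy.
  by rewrite zy; have [-> _] := pos_full_same fr eE sr pxy.
have srx : size r = size (nseq (size r) x) by rewrite size_nseq.
have [[e [w [eE fr nb dE]]]|[e [eE fr pe]]] := copy_descent x srx (IHr _ srx rx).
  left; exists e, (x :: w); split=> //.
  have sw : size w = size r by have [] := neighbour_size nb.
  by rewrite !inner_dist_cons ?sw // (negPf xy) dE.
right; exists e; split=> //; apply: contraNneq rx => pxy.
by have [_ <-] := pos_full_same fr eE sr pxy; [|apply/eqP].
Qed.

Lemma word_dist_descent u v : size u = size v -> u != v ->
  exists e u', [/\ e \in E, neighbour e u u' & word_dist u v = (word_dist u' v).+1].
Proof.
move=> suv uv; have [[e [u' [eE fu uu' dE]]]|[e [eE fu pe]]] := word_descent suv uv.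
  exists e, u'; split=> //; rewrite /word_dist dE; congr (_ + _).+1.
  apply: eq_cycle_sum => [|f fE _]; first by rewrite (neighbour_size uu').
  by rewrite (neighbour_pos_notfull eE uu').
have [u' uu' dE] := cycle_neighbour eE fu suv pe.
exists e, u'; split=> //; rewrite /word_dist (neighbour_inner_dist eE fu uu' suv).
have := cycle_sum_neighbour predT v eE uu'.
by rewrite dE /=; lia.
Qed.

(** * Transfer to the Schreier graph *)

Section Schreier.
Variable n : nat.
Implicit Types (s t : n.-tuple T).
Local Notation tdist := (fun s t : n.-tuple T => word_dist (rev s) (rev t)).

Lemma schreier_adjP s t :
  reflect (exists2 e, e \in E & neighbour e (rev s) (rev t)) (schreier_adj E n s t).
Proof.
have actE e s' t' : (edge_act e s' == val t' :> seq T) = (rev t' == ract e (rev s')).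
  by rewrite -{1}[s' : seq T]revK edge_act_rev -(inj_eq (can_inj revK)) revK eq_sym.
apply: (iffP hasP) => -[e eE].
  by rewrite !actE => /orP[]/eqP st; exists e => //; [left|right].
by move=> st; exists e => //; rewrite !actE; case: st => ->; rewrite eqxx ?orbT.
Qed.

Lemma tdist_lip s s' t : schreier_adj E n s s' -> tdist s t <= (tdist s' t).+1.
Proof.
case/schreier_adjP=> e eE [->|ss'].
  by have [] := @word_dist_ract e (rev s) (rev t) eE; rewrite ?size_rev ?size_tuple.
by rewrite ss'; have [] := @word_dist_ract e (rev s') (rev t) eE;
  rewrite ?size_rev ?size_tuple.
Qed.

Lemma tdist_descent s t : s != t ->
  exists2 s', schreier_adj E n s s' & tdist s t = (tdist s' t).+1.
Proof.
move=> st; have [||e [u' [eE su' dE]]] := @word_dist_descent (rev s) (rev t).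
- by rewrite !size_rev !size_tuple.
- by apply: contraNneq st => /(can_inj revK)/val_inj->.
have sz : size (rev u') == n.
  by rewrite size_rev (neighbour_size su') size_rev size_tuple.
exists (Tuple sz); last by rewrite /= revK.
by apply/schreier_adjP; exists e; rewrite //= revK.
Qed.

Lemma schreier_connected : connected_graph (schreier_adj E n).
Proof.
exact: (dist_connected (fun s => word_distxx (rev s)) tdist_descent).
Qed.

Lemma schreier_gdistE s t : gdist (schreier_adj E n) s t = word_dist (rev s) (rev t).
Proof. exact: (gdistE (fun s => word_distxx (rev s)) tdist_lip tdist_descent). Qed.

End Schreier.

End WordDistance.

(** * Sums over all words of a given length *)

Section WordSums.
Variables (T : finType) (E : seq (T * T)).
Implicit Types (e f : T * T) (x y z : T) (r u v w : seq T) (n : nat).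
Local Notation side := (side E).
Local Notation pos := (pos E).

Fixpoint words n : seq (seq T) :=
  if n is n'.+1 then [seq x :: r | x <- enum T, r <- words n'] else [:: [::]].

Lemma mem_words n r : (r \in words n) = (size r == n).
Proof.
elim: n r => [|n IHn] r; first by rewrite inE size_eq0.
apply/allpairsP/eqP => [[[y w] /= [_ + ->]]|]; first by rewrite IHn => /eqP <-.
by case: r => // x r [sr]; exists (x, r); rewrite /= mem_enum IHn sr eqxx.
Qed.

Lemma size_words n : size (words n) = #|T| ^ n.
Proof. by elim: n => //= n IHn; rewrite size_allpairs IHn -cardE expnS. Qed.

Lemma uniq_words n : uniq (words n).
Proof.
elim: n => //= n IHn; apply: allpairs_uniq; rewrite ?enum_uniq //.
by move=> [x r] [y r'] _ _ [-> ->].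
Qed.

Lemma sum_wordsS n (F : seq T -> nat) :
  \sum_(v <- words n.+1) F v = \sum_x \sum_(r <- words n) F (x :: r).
Proof. by rewrite big_allpairs_dep big_enum. Qed.

Lemma sum_tuples n (F : seq T -> nat) :
  \sum_(t : n.-tuple T) F (rev t) = \sum_(r <- words n) F r.
Proof.
transitivity (\sum_(r <- map (fun t : n.-tuple T => rev t) (enum {: n.-tuple T})) F r).
  by rewrite big_map big_enum.
apply: perm_big; apply: uniq_perm; rewrite ?uniq_words //.
  by rewrite map_inj_uniq ?enum_uniq // => s t /(can_inj revK)/val_inj.
move=> r; rewrite mem_words; apply/mapP/eqP => [[t _ ->]|sr].
  by rewrite size_rev size_tuple.
have sz : size (rev r) == n by rewrite size_rev sr.
by exists (Tuple sz); rewrite ?mem_enum //= revK.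
Qed.

Lemma sum_words_const n c : \sum_(r <- words n) c = #|T| ^ n * c.
Proof. by rewrite big_const_seq count_predT size_words iter_addn_0 mulnC. Qed.

Lemma eq_sum_words n (F F' : seq T -> nat) :
  (forall r, size r = n -> F r = F' r) ->
  \sum_(r <- words n) F r = \sum_(r <- words n) F' r.
Proof.
by move=> eqF; apply: eq_big_seq => r; rewrite mem_words => /eqP; apply: eqF.
Qed.

(* Size of one side of e, its endpoint excluded. *)
Definition inner_side e (b : bool) := #|[pred x | ~~ on_edge e x & side e x == b]|.

Lemma sum_off_edge e (F : bool -> nat) :
  \sum_(x | off_edge x e) F (side e x) =
  inner_side e true * F true + inner_side e false * F false.
Proof.
rewrite (bigID (side e)) /= /inner_side -!sum_nat_const; congr (_ + _).
  by apply: eq_big => x; rewrite ?inE ?eqb_id // => /andP[_ ->].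
by apply: eq_big => x; rewrite ?inE ?eqbF_neg // => /andP[_ /negPf->].
Qed.

Hypothesis treeE : oriented_tree E.

Lemma sum_edge_split e (F : T -> nat) : e \in E ->
  \sum_x F x = F e.1 + F e.2 + \sum_(x | off_edge x e) F x.
Proof.
move=> eE; rewrite (bigD1 e.1) //= (bigD1 e.2) /= ?addnA.
  by congr (_ + _); apply: eq_bigl => x; rewrite -negb_or.
by rewrite eq_sym (tree_edge_neq treeE).
Qed.

Lemma card_inner_side e : e \in E ->
  #|T| = (inner_side e true + inner_side e false).+2.
Proof.
move=> eE; rewrite -sum1_card (sum_edge_split _ eE).
by rewrite (sum_off_edge e (fun=> 1)) !muln1.
Qed.

Lemma cycle_dist_ends n b c :
  cycle_dist (2 ^ n.+1) (end_pos n.+1 b) (end_pos n.+1 c) = (b != c).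
Proof.
rewrite /cycle_dist /end_pos expnS; have : 0 < 2 ^ n by rewrite expn_gt0.
by case: b; case: c => /=; lia.
Qed.

(* The two letters of e put a point and its antipode on the doubled cycle, so
   the sum does not depend on r. *)
Lemma sum_cycle_dist_letter e r q : e \in E -> q < 2 ^ (size r).+1 ->
  \sum_x cycle_dist (2 ^ (size r).+1) (pos e (x :: r)) q =
  2 ^ size r
  + (inner_side e true * cycle_dist (2 ^ (size r).+1) (end_pos (size r).+1 true) q
     + inner_side e false * cycle_dist (2 ^ (size r).+1) (end_pos (size r).+1 false) q).
Proof.
move=> eE qlt; rewrite (sum_edge_split _ eE) /= on_edge1 on_edge2 side1 side2 //.
congr (_ + _).
  rewrite mul0n mul1n add0n expnS cycle_dist_half ?pos_lt //.
  by rewrite -expnS.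
rewrite -(sum_off_edge e (fun b => cycle_dist _ (end_pos _ b) q)).
by apply: eq_bigr => x /negPf->.
Qed.

(** Since the two ends are adjacent on the cycle, each last letter off [e] on the opposite side
    contributes 1 and those on the same side contribute 0. *)
Lemma sum_cycle_dist_end e n b : e \in E ->
  \sum_(r <- words n.+1) cycle_dist (2 ^ n.+1) (end_pos n.+1 b) (pos e r) =
  #|T| ^ n * (2 ^ n + inner_side e (~~ b)).
Proof.
move=> eE; rewrite sum_wordsS exchange_big -sum_words_const.
apply: eq_sum_words => r <-.
rewrite (eq_bigr _ (fun x _ => cycle_distC _ _ _)) sum_cycle_dist_letter //; last first.
  rewrite /end_pos; have : 0 < 2 ^ (size r).+1 by rewrite expn_gt0.
  by case: b => /=; lia.
by rewrite !cycle_dist_ends; case: b => /=; rewrite ?muln0 ?muln1 ?addn0.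
Qed.

Lemma sum_cycle_dist e n : e \in E ->
  \sum_(r <- words n.+1) \sum_(r' <- words n.+1)
     cycle_dist (2 ^ n.+1) (pos e r) (pos e r') =
  #|T| ^ n * (#|T| ^ n.+1 * 2 ^ n
    + (inner_side e true * (#|T| ^ n * (2 ^ n + inner_side e false))
       + inner_side e false * (#|T| ^ n * (2 ^ n + inner_side e true)))).
Proof.
move=> eE; rewrite exchange_big.
rewrite (eq_sum_words (F' := fun r' => #|T| ^ n * (2 ^ n
  + (inner_side e true * cycle_dist (2 ^ n.+1) (end_pos n.+1 true) (pos e r')
     + inner_side e false * cycle_dist (2 ^ n.+1) (end_pos n.+1 false) (pos e r'))))).
  rewrite -big_distrr big_split big_split -!big_distrr /= !sum_cycle_dist_end //.
  by rewrite (sum_words_const n.+1).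
move=> r' sr'; rewrite sum_wordsS exchange_big -sum_words_const.
apply: eq_sum_words => r sr; rewrite -{}sr in sr' *; apply: sum_cycle_dist_letter => //.
by have := pos_lt E e r'; rewrite sr'.
Qed.

Definition height_sum n := \sum_(v <- words n) height E v.

Definition inner_sum n :=
  \sum_(u <- words n) \sum_(v <- words n) inner_dist E u v.

Definition cycle_total n := \sum_(e <- E)
  \sum_(u <- words n) \sum_(v <- words n) cycle_dist (2 ^ n) (pos e u) (pos e v).

Lemma height_sumS n : height_sum n.+1 = #|T| * height_sum n +
  \sum_(e <- E) (inner_side e true *
      \sum_(r <- words n) cycle_dist (2 ^ n) (end_pos n true) (pos e r)
    + inner_side e false *
      \sum_(r <- words n) cycle_dist (2 ^ n) (end_pos n false) (pos e r)).
Proof.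
rewrite /height_sum sum_wordsS /=.
rewrite (eq_bigr _ (fun x _ => big_split _ _ _ _ _)) big_split /= sum_nat_const.
congr (_ + _); under eq_bigr => x _.
  under eq_sum_words => r sr.
    rewrite sr /cycle_sum size_nseq big_mkcond.
    over.
  rewrite exchange_big.
  over.
rewrite exchange_big; apply: eq_bigr => e _.
rewrite -(sum_off_edge e (fun b => \sum_(r <- words n) cycle_dist _ (end_pos n b) (pos e r))).
rewrite [RHS]big_mkcond; apply: eq_bigr => x _; rewrite pos_nseq.
by case: ifP => // _; rewrite big1.
Qed.

Lemma sum_cycle_sum_off_edge n :
  \sum_x \sum_(u <- words n) \sum_(v <- words n) cycle_sum E (off_edge x) u v =
  \sum_(e <- E) (inner_side e true + inner_side e false) *
     \sum_(u <- words n) \sum_(v <- words n) cycle_dist (2 ^ n) (pos e u) (pos e v).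
Proof.
pose c e u v := cycle_dist (2 ^ n) (pos e u) (pos e v).
transitivity (\sum_x \sum_(e <- E | off_edge x e)
    \sum_(u <- words n) \sum_(v <- words n) c e u v).
  apply: eq_bigr => x _; rewrite [RHS]exchange_big; apply: eq_sum_words => u su.
  by rewrite [RHS]exchange_big; apply: eq_bigr => v _; rewrite /cycle_sum su.
under eq_bigr => x _ do rewrite big_mkcond.
rewrite exchange_big; apply: eq_bigr => e _; rewrite -big_mkcond /=.
by rewrite (sum_off_edge e (fun=> \sum_(u <- words n) \sum_(v <- words n) c e u v)) mulnDl.
Qed.

Lemma inner_sumS n : inner_sum n.+1 + 2 * #|T| ^ n * height_sum n.+1 =
  #|T| * inner_sum n
  + \sum_(e <- E) (inner_side e true + inner_side e false) *
     \sum_(u <- words n) \sum_(v <- words n) cycle_dist (2 ^ n) (pos e u) (pos e v)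
  + 2 * #|T| ^ n.+1 * height_sum n.+1.
Proof.
pose D x := \sum_(u <- words n) \sum_(v <- words n)
  (inner_dist E u v + cycle_sum E (off_edge x) u v).
pose H x := \sum_(u <- words n) height E (x :: u).
have HE : height_sum n.+1 = \sum_x H x by rewrite /height_sum sum_wordsS.
have DE : \sum_x D x = #|T| * inner_sum n + \sum_x \sum_(u <- words n)
    \sum_(v <- words n) cycle_sum E (off_edge x) u v.
  rewrite -sum_nat_const -big_split; apply: eq_bigr => x _.
  by rewrite -big_split; apply: eq_bigr => u _; rewrite -big_split.
have HH x y : \sum_(u <- words n) \sum_(v <- words n)
    (height E (x :: u) + height E (y :: v)) = #|T| ^ n * (H x + H y).
  under eq_bigr => u _ do rewrite big_split sum_words_const /=.
  by rewrite big_split sum_words_const -big_distrr /= -mulnDr.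
(* Pairs in different copies contribute the sum of their heights; adding the missing term [y = x] on
   both sides lets [y] range over all letters. *)
have row x : \sum_y \sum_(u <- words n) \sum_(v <- words n)
      inner_dist E (x :: u) (y :: v) + 2 * #|T| ^ n * H x =
    D x + #|T| ^ n * \sum_y (H x + H y).
  rewrite (bigD1 x) //= [in RHS](bigD1 x) //= eqxx -/(D x).
  rewrite (eq_bigr (fun y => #|T| ^ n * (H x + H y))); first by rewrite -big_distrr /=; lia.
  by move=> y yx; rewrite eq_sym (negPf yx) HH.
rewrite -sum_cycle_sum_off_edge -DE HE {1}/inner_sum sum_wordsS.
transitivity (\sum_x (\sum_y \sum_(u <- words n) \sum_(v <- words n)
      inner_dist E (x :: u) (y :: v) + 2 * #|T| ^ n * H x)).
  rewrite big_split -big_distrr /=; congr (_ + _); apply: eq_bigr => x _.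
  by rewrite [RHS]exchange_big; apply: eq_bigr => u _; rewrite sum_wordsS.
rewrite (eq_bigr _ (fun x _ => row x)) big_split -big_distrr /=; congr (_ + _).
under eq_bigr => x _ do rewrite big_split sum_nat_const /=.
by rewrite big_split sum_nat_const -big_distrr /= expnS; ring.
Qed.

Lemma sum_word_dist n :
  \sum_(u <- words n) \sum_(v <- words n) word_dist E u v = inner_sum n + cycle_total n.
Proof.
rewrite /word_dist; under eq_bigr => u _ do rewrite big_split.
rewrite big_split /=; congr (_ + _); rewrite /cycle_total [RHS]exchange_big.
apply: eq_sum_words => u su; rewrite [RHS]exchange_big.
by apply: eq_bigr => v _; rewrite /cycle_sum su.
Qed.

(** On words of length one every cycle has length 2, and positions record sides. *)
Lemma sum_tree_dist : \sum_x \sum_y tree_dist E x y = cycle_total 1.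
Proof.
have posE e x : pos e [:: x] = end_pos 1 (side e x).
  by rewrite -(pos_nseq E e 1 x).
rewrite /cycle_total /tree_dist; under eq_bigr => x _ do rewrite exchange_big.
rewrite exchange_big; apply: eq_bigr => e _.
rewrite sum_wordsS; apply: eq_bigr => x _; rewrite big_seq1 sum_wordsS.
by apply: eq_bigr => y _; rewrite big_seq1 !posE cycle_dist_ends.
Qed.

End WordSums.

(** * Recurrences in terms of k = p + 2 *)

Section Recurrences.
Variables (T : finType) (E : seq (T * T)) (p : nat).
Hypotheses (treeE : oriented_tree E) (cardT : #|T| = p.+2).

(** For inner sides a + b = k - 2 one has (a + 1)(b + 1) = ab + (k - 1); over the k - 1 edges, the
    Wiener index of the tree is thus [branch_sum] plus (k - 1)^2. *)
Definition branch_sum := \sum_(e <- E) inner_side E e true * inner_side E e false.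

Lemma inner_side_sum e : e \in E -> inner_side E e true + inner_side E e false = p.
Proof. by move=> eE; have := card_inner_side treeE eE; rewrite cardT => -[]. Qed.

Lemma sum_edges_const c : \sum_(e <- E) c = p.+1 * c.
Proof.
rewrite big_const_seq count_predT iter_addn_0 mulnC; congr (_ * _).
by have := size_tree treeE; rewrite cardT => /(_ isT) [].
Qed.

Lemma cycle_totalS n : cycle_total E n.+1 =
  (p.+2 ^ n) ^ 2 * (2 ^ n * (2 * p.+1 ^ 2) + 2 * branch_sum).
Proof.
rewrite /cycle_total mulnDr /branch_sum !big_distrr /=.
have -> : (p.+2 ^ n) ^ 2 * (2 ^ n * (2 * p.+1 ^ 2)) =
    \sum_(e <- E) (p.+2 ^ n) ^ 2 * (2 ^ n * (2 * p.+1)).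
  by rewrite sum_edges_const; ring.
rewrite -big_split; apply: eq_big_seq => e eE /=.
rewrite sum_cycle_dist // cardT -(inner_side_sum eE) expnS; ring.
Qed.

Lemma height_sum1 : height_sum E 1 = 0.
Proof.
by rewrite /height_sum sum_wordsS big1 // => x _; rewrite big_seq1 /= cycle_sumxx.
Qed.

Lemma inner_sum1 : inner_sum E 1 = 0.
Proof.
rewrite /inner_sum sum_wordsS big1 // => x _; rewrite big_seq1 sum_wordsS big1 // => y _.
by rewrite big_seq1 /= !cycle_sumxx if_same.
Qed.

Lemma height_sum_rec n : height_sum E n.+2 =
  p.+2 * height_sum E n.+1 + p.+2 ^ n * (p.+1 * p * 2 ^ n + 2 * branch_sum).
Proof.
rewrite height_sumS cardT; congr (_ + _).
rewrite mulnDr /branch_sum !big_distrr /=.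
have -> : p.+2 ^ n * (p.+1 * p * 2 ^ n) = \sum_(e <- E) p.+2 ^ n * (p * 2 ^ n).
  by rewrite sum_edges_const; ring.
rewrite -big_split; apply: eq_big_seq => e eE /=.
rewrite !sum_cycle_dist_end // cardT /= -(inner_side_sum eE); ring.
Qed.

(** The factor [p] counts the copies of letters off [e], in which the longest [e]-cycle stays
    closed. *)
Lemma inner_sum_rec n : inner_sum E n.+2 + 2 * p.+2 ^ n.+1 * height_sum E n.+2 =
  p.+2 * inner_sum E n.+1 + p * cycle_total E n.+1
  + 2 * p.+2 ^ n.+2 * height_sum E n.+2.
Proof.
have := inner_sumS E n.+1; rewrite cardT => ->; congr (_ + _ + _).
rewrite /cycle_total big_distrr; apply: eq_big_seq => e eE.
by rewrite inner_side_sum.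
Qed.

End Recurrences.

(** * Solving the recurrences *)

Section ClosedForm.
Local Open Scope ring_scope.

Lemma height_recurrence (F : numFieldType) (q M : F) (h : nat -> F) (n : nat) :
  h 0%N = 0 ->
  (forall m, h m.+1 = q * h m + q ^+ m * ((q - 1) * (q - 2) * 2 ^+ m + 2 * M)) ->
  h n.+1 = q ^+ n * ((q - 1) * (q - 2) * (2 ^+ n.+1 - 1) + 2 * M * n.+1%:R).
Proof.
move=> h0 recE; elim: n => [|n IHn]; first by rewrite recE h0 !expr0 expr1; ring.
by rewrite recE IHn -[n.+2%:R]natr1 !exprS; ring.
Qed.

(** The sequences are indexed by word length minus one, and [M + (q - 1) ^+ 2] stands for the Wiener
    index of the tree. *)
Lemma inner_recurrence (F : numFieldType) (q M : F) (s c h : nat -> F) (n : nat) :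
  q != 0 -> q - 1 != 0 -> 2 * q - 1 != 0 ->
  s 0%N = 0 ->
  (forall m, c m = q ^+ m ^+ 2 * (2 ^+ m * (2 * (q - 1) ^+ 2) + 2 * M)) ->
  (forall m, h m.+1 = q ^+ m * ((q - 1) * (q - 2) * (2 ^+ m.+1 - 1) + 2 * M * m.+1%:R)) ->
  (forall m, s m.+1 = q * s m + (q - 2) * c m + 2 * (q - 1) * q ^+ m.+1 * h m.+1) ->
  (s n + c n) / 2 =
      (q - 1) ^+ 2 * (2 * q ^+ 2 - 2 * q - 1) / (q ^+ 3 * (2 * q - 1))
        * 2 ^+ n.+1 * q ^+ (2 * n.+1)
    - 2 * (q - 1) ^+ 2 / q ^+ 2 * n.+1%:R * q ^+ (2 * n.+1)
    + 2 * (q + 1) * (q - 1) / q ^+ 3 * q ^+ (2 * n.+1)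
    - 2 * (q + 1) * (q - 1) / (q * (2 * q - 1)) * q ^+ n.+1
    + (2 / q ^+ 2 * n.+1%:R * q ^+ (2 * n.+1)
       - (q ^+ 2 + 2) / (q ^+ 3 * (q - 1)) * q ^+ (2 * n.+1)
       + (q + 2) / (q ^+ 2 * (q - 1)) * q ^+ n.+1) * (M + (q - 1) ^+ 2).
Proof.
move=> q0 q1 q2 s0 cE hE sE; have n2 : 2 != 0 :> F by rewrite pnatr_eq0.
rewrite cE [(2 * n.+1)%N]mulnC exprM; elim: n => [|n IHn].
  by rewrite s0 !expr0 expr1n !expr1; field; rewrite q0 q1 q2.
(* The induction hypothesis is solved for [s n]. *)
move/(canRL (divfK n2))/(canRL (addrK _)): IHn => IHn.
rewrite sE IHn cE hE -[n.+2%:R]natr1 !exprS expr0 !mulr1.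
by field; rewrite q0 q1 q2.
Qed.

End ClosedForm.

(** * Wiener indices *)

Local Open Scope ring_scope.

Lemma wiener_schreier (T : finType) (E : seq (T * T)) (n : nat) : oriented_tree E ->
  wiener (schreier_adj E n) = (inner_sum E n + cycle_total E n)%:R / 2.
Proof.
move=> treeE; rewrite /wiener -sum_word_dist -sum_tuples; congr (_%:R / _).
apply: eq_bigr => u _; rewrite -sum_tuples; apply: eq_bigr => v _.
exact: schreier_gdistE.
Qed.

Lemma wiener_tree (T : finType) (E : seq (T * T)) : oriented_tree E ->
  wiener (tree_adj E) = (cycle_total E 1)%:R / 2.
Proof.
move=> treeE; rewrite /wiener -sum_tree_dist; congr (_%:R / _).
by apply: eq_bigr => u _; apply: eq_bigr => v _; exact: tree_gdistE.
Qed.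

Lemma wiener_le1 (V : finType) (adj : rel V) : (#|V| <= 1)%N -> wiener adj = 0.
Proof.
move=> V1; rewrite /wiener big1 ?mul0r // => x _; rewrite big1 // => y _.
have -> : y = x by apply: (fintype_le1P V1).
have cV : #|V| = 1%N.
  by apply/eqP; rewrite eqn_leq V1; apply/card_gt0P; exists x.
rewrite /gdist cV /=; case: existsP => // -[].
by exists [tuple]; rewrite /= eqxx.
Qed.

Theorem theorem5p1 (T : finType) (E : seq (T * T)) (n : nat) :
  oriented_tree E -> (1 <= n)%N ->
  let k : rat := (#|T|)%:R in
  let N : rat := n%:R in
  connected_graph (schreier_adj E n) /\
  wiener (schreier_adj E n) =
      (k - 1) ^+ 2 * (2 * k ^+ 2 - 2 * k - 1) / (k ^+ 3 * (2 * k - 1))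
        * 2 ^+ n * k ^+ (2 * n)
    - 2 * (k - 1) ^+ 2 / k ^+ 2 * N * k ^+ (2 * n)
    + 2 * (k + 1) * (k - 1) / k ^+ 3 * k ^+ (2 * n)
    - 2 * (k + 1) * (k - 1) / (k * (2 * k - 1)) * k ^+ n
    + (2 / k ^+ 2 * N * k ^+ (2 * n)
       - (k ^+ 2 + 2) / (k ^+ 3 * (k - 1)) * k ^+ (2 * n)
       + (k + 2) / (k ^+ 2 * (k - 1)) * k ^+ n) * wiener (tree_adj E).
Proof.
move=> treeE n_gt0 k N; split; first exact: schreier_connected.
(* For k at most 1 some denominators vanish, and division by 0 gives 0; both Wiener indices are 0,
   and the other terms contain a positive power of k = 0 or a factor k - 1 = 0. *)
have [T_le1|] := leqP #|T| 1.
  have wT : wiener (tree_adj E) = 0 by exact: wiener_le1.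
  have wS : wiener (schreier_adj E n) = 0.
    by apply: wiener_le1; rewrite card_tuple -(exp1n n) leq_exp2r.
  rewrite wT wS mulr0 addr0; case: (posnP #|T|) T_le1 @k => [->|T_gt0 T_le1] k.
    by rewrite /k !expr0n ?muln_eq0 /= !gtn_eqF // !(mulr0, oppr0, addr0).
  have -> : k = 1 by rewrite /k; case: #|T| T_gt0 T_le1 => [|[]].
  by rewrite !subrr expr0n /= !(mul0r, mulr0, oppr0, addr0).
move=> T_gt1; pose p := #|T|.-2; have cardT : #|T| = p.+2 by rewrite /p; lia.
have p0 : 0 <= p%:R :> rat by rewrite ler0n.
have kp : p.+2%:R = k by rewrite -cardT.
have kE : k = p%:R + 2 by rewrite -kp -addn2 natrD.
clearbody k p.
have cE m : (cycle_total E m.+1)%:R =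
    k ^+ m ^+ 2 * (2 ^+ m * (2 * (k - 1) ^+ 2) + 2 * (branch_sum E)%:R).
  rewrite (cycle_totalS treeE cardT) !(natrD, natrM, natrX) kp.
  by rewrite kE -[p.+1%:R]natr1; ring.
case: n n_gt0 @N => // n _ N; rewrite wiener_schreier // wiener_tree // natrD.
have -> : (cycle_total E 1)%:R / 2 = (branch_sum E)%:R + (k - 1) ^+ 2 :> rat.
  by rewrite cE !expr0 expr1n; field.
apply: (@inner_recurrence _ k (branch_sum E)%:R (fun m => (inner_sum E m.+1)%:R)
  (fun m => (cycle_total E m.+1)%:R) (fun m => (height_sum E m.+1)%:R)) => //.
- by rewrite -kp pnatr_eq0.
- by rewrite kE; apply/eqP; lra.
- by rewrite kE; apply/eqP; lra.
- by rewrite inner_sum1.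
- move=> m; apply: (@height_recurrence _ k _ (fun i => (height_sum E i.+1)%:R)).
    by rewrite height_sum1.
  move=> i; rewrite (height_sum_rec treeE cardT) !(natrD, natrM, natrX) kp.
  by rewrite kE -[p.+1%:R]natr1; ring.
move=> m; have /(congr1 (fun i => i%:R : rat)) := inner_sum_rec treeE cardT m.
by rewrite !(natrD, natrM, natrX) kp [k ^+ m.+2]exprS kE => ?; lra.
Qed.
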